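(* Let $\mathsf{A}_{\mathrm{sel}}$ be a set (the selective action domain), let $\mathsf{A}_{\mathrm{exh}}\subseteq 2^{\mathsf{A}_{\mathrm{sel}}}$ (the exhaustive action domain), let $\mathcal M$ be a class of probability distributions on an observation domain $\mathsf O$, and let $T\colon\mathcal M\to\mathsf{A}_{\mathrm{exh}}\subseteq 2^{\mathsf{A}_{\mathrm{sel}}}$ be a set-valued functional with the proper-subset property. Then $T$ cannot be both selectively elicitable and exhaustively elicitable (on $\mathcal M$).
   Context: $(\mathsf O,\mathcal O)$ is a measurable space, $\mathcal M$ is a class of probability measures on it, and $\mathbb R^*=(-\infty,\infty]$. All functions are tacitly measurable. For a scoring function $S\colon \mathsf A\times\mathsf O\to\mathbb R^*$ on an action domain $\mathsf A$ put $\bar S(x,F)=\int S(x,y)\,dF(y)$, assumed to exist in $(-\infty,\infty]$ for all $x\in\mathsf A$, $F\in\mathcal M$. All scoring functions are assumed $\mathcal M$-finite, i.e. $\bar S(x,F)<\infty$ for all $x\in\mathsf A$, $F\in\mathcal M$. Selective: $S\colon\mathsf A_{\mathrm{sel}}\times\mathsf O\to\mathbb R^*$ is strictly $\mathcal M$-consistent for $T\colon\mathcal M\to 2^{\mathsf A_{\mathrm{sel}}}$ if $\bar S(t,F)\le\bar S(x,F)$ for all $x\in\mathsf A_{\mathrm{sel}}$, $t\in T(F)$, $F\in\mathcal M$, and equality implies $x\in T(F)$. $T$ is selectively elicitable if there is such an ($\mathcal M$-finite) $S$. Exhaustive: $S\colon\mathsf A_{\mathrm{exh}}\times\mathsf O\to\mathbb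 R^*$ is strictly $\mathcal M$-consistent for $T\colon\mathcal M\to\mathsf A_{\mathrm{exh}}$ if $\bar S(T(F),F)\le\bar S(B,F)$ for all $B\in\mathsf A_{\mathrm{exh}}$, $F\in\mathcal M$, and equality implies $B=T(F)$. $T$ is exhaustively elicitable if there is such an ($\mathcal M$-finite) $S$. Proper-subset property: there are $F,G\in\mathcal M$ such that $\emptyset\ne T(G)\subsetneq T(F)$ and for all $\varepsilon\in(0,1)$ there exists $\lambda_0\in(0,\varepsilon)$ with $(1-\lambda_0)F+\lambda_0G\in\mathcal M$. *)

(* Defs.v *)
From mathcomp Require Import all_boot all_order all_algebra.
From mathcomp Require Import all_classical all_reals all_analysis.
From mathcomp Require Import measurable_realfun.

Set Implicit Arguments.
Unset Strict Implicit.
Unset Printing Implicit Defensive.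

Import Order.TTheory GRing.Theory Num.Theory.

Local Open Scope classical_set_scope.
Local Open Scope ring_scope.
Local Open Scope ereal_scope.

Section Elicitability.
Context (d : measure_display) (O : measurableType d) (R : realType).
Implicit Types (M : set (probability O R)) (F G H : probability O R).

Definition expected_score (A : Type) (S : A -> O -> \bar R) (x : A)
    (F : probability O R) : \bar R :=
  \int[F]_y S x y.

(** The action domain is a subset [D] of the type [A]; values of [S] outside
    [D] are irrelevant. The library integral is total, with the convention
    [+oo - +oo = -oo], so its existence in (-oo, +oo] is required separately:
    the negative part must have finite integral. *)
Definition scoring_function (A : Type) (D : set A) M (S : A -> O -> \bar R) :=
  forall x, D x ->
    [/\ measurable_fun [set: O] (S x),
        (forall y, -oo < S x y) &
        (forall F, M F -> \int[F]_y (S x)^\- y < +oo)].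

Definition finite_score (A : Type) (D : set A) M (S : A -> O -> \bar R) :=
  forall x F, D x -> M F -> expected_score S x F < +oo.

Section Functional.
Variable Asel : Type.
Implicit Types (Aexh : set (set Asel)) (T : probability O R -> set Asel).

Definition sel_strictly_consistent M T (S : Asel -> O -> \bar R) :=
  forall (x t : Asel) F, M F -> T F t ->
    expected_score S t F <= expected_score S x F /\
    (expected_score S t F = expected_score S x F -> T F x).

Definition selectively_elicitable M T :=
  exists S : Asel -> O -> \bar R,
    [/\ scoring_function [set: Asel] M S,
        finite_score [set: Asel] M S &
        sel_strictly_consistent M T S].

Definition exh_strictly_consistent Aexh M T (S : set Asel -> O -> \bar R) :=
  forall (B : set Asel) F, Aexh B -> M F ->
    expected_score S (T F) F <= expected_score S B F /\
    (expected_score S (T F) F = expected_score S B F -> B = T F).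

Definition exhaustively_elicitable Aexh M T :=
  exists S : set Asel -> O -> \bar R,
    [/\ scoring_function Aexh M S,
        finite_score Aexh M S &
        exh_strictly_consistent Aexh M T S].

(** [H] is the mixture (1 - l) F + l G. Equality is only required on
    measurable sets, since the values of a [probability] on non-measurable
    sets carry no meaning. *)
Definition is_mixture (l : R) F G H :=
  forall E : set O, measurable E -> H E = (1 - l)%:E * F E + l%:E * G E.

Definition proper_subset_property M T :=
  exists F G, [/\ M F, M G, T G !=set0, T G `<` T F &
    forall eps : R, (0 < eps < 1)%R ->
      exists2 l : R, (0 < l < eps)%R & exists2 H, M H & is_mixture l F G H].

End Functional.
End Elicitability.

(* Main.v *)
(** For small [l], the mixture [H] of [F] and [G] with weight [l] is close enough
    to [F] that the exhaustive score still ranks [T F] strictly above both [T G]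
    and the empty set at [H]; hence [T H] is neither of them. But a common point
    of [T F] and [T G] minimizes the selective expected score at [F] and at [G],
    hence at [H], and linearity of the score in the distribution forces
    [T H = T G] as soon as [T H] is nonempty. *)

Require Import Defs.
From mathcomp Require Import all_boot all_order all_algebra.
From mathcomp Require Import all_classical all_reals all_analysis.
From mathcomp Require Import measurable_realfun.
From mathcomp Require Import ring lra.

Import Order.TTheory GRing.Theory Num.Theory.

Local Open Scope classical_set_scope.
Local Open Scope ring_scope.

Section ScoresAtMixtures.
Set Implicit Arguments.
Unset Strict Implicit.
Context (d : measure_display) (O : measurableType d) (R : realType).
Implicit Types F G H : probability O R.

Lemma ge0_integral_mixture (l : R) F G H (f : O -> \bar R) :
  0 <= l <= 1 -> is_mixture l F G H ->
  measurable_fun [set: O] f -> (forall y, 0 <= f y)%E ->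
  (\int[H]_y f y = (1 - l)%:E * \int[F]_y f y + l%:E * \int[G]_y f y)%E.
Proof.
move=> /andP[l0 l1] mixH mf f0.
have l1' : 0 <= 1 - l by rewrite subr_ge0.
(* The integral depends only on measurable sets, and there [H] agrees with a sum of two scaled
   measures. *)
rewrite (eq_measure_integral
  (measure_add (mscale (NngNum l1') F) (mscale (NngNum l0) G))); last first.
  by move=> A mA _; rewrite [RHS]measure_addE; exact: mixH.
by rewrite ge0_integral_measure_add// !ge0_integral_mscale.
Qed.

Section Score.
Context (A : Type) (D : set A) (M : set (probability O R)) (S : A -> O -> \bar R).
Hypotheses (S_score : scoring_function D M S) (S_fin : finite_score D M S).

(** Existence of the integral bounds the negative part, finiteness of the score then bounds the
    positive part. So no [+oo - +oo] arises when mixtures are treated part by part. *)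
Lemma integral_funeparts_fin_num x F : D x -> M F ->
  (\int[F]_y (S x)^\+%E y)%E \is a fin_num /\
  (\int[F]_y (S x)^\-%E y)%E \is a fin_num.
Proof.
move=> Dx MF; have [_ _ /(_ F MF) neg_lty] := S_score Dx.
have neg_fin : (\int[F]_y (S x)^\-%E y)%E \is a fin_num.
  by rewrite ge0_fin_numE// integral_ge0.
split=> //; rewrite ge0_fin_numE; last exact: integral_ge0.
have := S_fin Dx MF; rewrite /expected_score integralE.
by rewrite -(fineK neg_fin) lteBlDr.
Qed.

Lemma expected_score_fin_num x F :
  D x -> M F -> expected_score S x F \is a fin_num.
Proof.
move=> Dx MF; have [? ?] := integral_funeparts_fin_num Dx MF.
by rewrite /expected_score integralE fin_numB; apply/andP.
Qed.

Lemma expected_score_mixture (l : R) F G H x :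
  0 <= l <= 1 -> is_mixture l F G H -> D x -> M F -> M G ->
  expected_score S x H =
  ((1 - l) * fine (expected_score S x F) + l * fine (expected_score S x G))%:E.
Proof.
move=> l01 mixH Dx MF MG; have [mS _ _] := S_score Dx.
have [Fp Fn] := integral_funeparts_fin_num Dx MF.
have [Gp Gn] := integral_funeparts_fin_num Dx MG.
rewrite /expected_score 3!(integralE _ _ (S x)).
rewrite !(ge0_integral_mixture l01 mixH)//;
  [|exact: measurable_funeneg|exact: measurable_funepos].
move: Fp Fn Gp Gn => /fineK<- /fineK<- /fineK<- /fineK<-.
by rewrite -!EFinM -!EFinD; congr EFin => /=; ring.
Qed.

End Score.

Lemma lt_mixture (a b c e : R) : a < b ->
  exists2 eps, 0 < eps < 1 &
    forall l, 0 < l < eps -> (1 - l) * a + l * c < (1 - l) * b + l * e.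
Proof.
move=> ab; have [k0 kce] : 0 <= `|c - e| /\ c - e <= `|c - e| by rewrite ler_norm.
set k := `|c - e| in k0 kce *.
have den0 : 0 < b - a + k + 1 by lra.
(* The goal amounts to [l * (b - a + (c - e)) < b - a], and [k] bounds [c - e]. The summand 1 keeps
   the quotient below 1 even when [k = 0]. *)
exists ((b - a) / (b - a + k + 1)).
  by rewrite ltr_pdivrMr// divr_gt0//=; lra.
by move=> l /andP[l0]; rewrite ltr_pdivlMr// => ?; nra.
Qed.

Section Functional.
Context (Asel : Type) (M : set (probability O R)) (T : probability O R -> set Asel).

(** The strict score gap between [T F] and [B] at [F] survives a small admixture of [G]. To be
    applied with [B] equal to [T G] and to the empty set. *)
Lemma exhaustive_mixture_neq (Aexh : set (set Asel)) F G (B : set Asel) :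
  (forall F, M F -> Aexh (T F)) -> exhaustively_elicitable Aexh M T ->
  M F -> M G -> B <> T F ->
  exists2 eps : R, 0 < eps < 1 &
    forall l H, 0 < l < eps -> M H -> is_mixture l F G H -> T H <> B.
Proof.
move=> TA [S [S_score S_fin S_cons]] MF MG BF.
have [AB|nAB] := pselect (Aexh B); last first.
  (* [Aexh] need not contain [B], for instance the empty set; then [T] never takes the value [B] on
     [M], and any threshold works. *)
  exists (1 / 2); first lra.
  by move=> l H _ MH _ THB; apply: nAB; rewrite -THB; exact: TA.
have fin := expected_score_fin_num S_score S_fin.
have lt_F : fine (expected_score S (T F) F) < fine (expected_score S B F).
  have [le_F eq_F] := S_cons B F AB MF.
  rewrite fine_lt ?fin//; first exact: TA.
  by rewrite lt_neqAle le_F andbT; apply/eqP => /eq_F.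
have [eps eps01 lt_eps] := lt_mixture
  (fine (expected_score S (T F) G)) (fine (expected_score S B G)) lt_F.
exists eps => // l H l_eps MH mixH THB.
have l01 : 0 <= l <= 1 by lra.
(* If [T H = B], consistency at [H] against the competitor [T F] reverses the surviving strict
   inequality. *)
have [+ _] := S_cons (T F) H (TA _ MF) MH; rewrite THB.
rewrite !(expected_score_mixture S_score S_fin l01 mixH)//; last exact: TA.
by rewrite lee_fin leNgt lt_eps.
Qed.

Lemma selective_mixture_eq (l : R) F G H :
  selectively_elicitable M T -> M F -> M G -> M H ->
  0 < l < 1 -> is_mixture l F G H ->
  T G !=set0 -> T G `<=` T F -> T H !=set0 -> T H = T G.
Proof.
move=> [S [S_score S_fin S_cons]] MF MG MH l01 mixH [g Gg] GF [h Hh].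
have l01' : 0 <= l <= 1 by lra.
have fin := expected_score_fin_num S_score S_fin.
have mixS x := expected_score_mixture S_score S_fin l01' mixH (I : setT x) MF MG.
pose s x F := fine (expected_score S x F).
have le x t K : M K -> T K t -> s t K <= s x K.
  by move=> MK Kt; apply: fine_le; rewrite ?fin//; have [] := S_cons x t K MK Kt.
have eqT x t K : M K -> T K t -> s t K = s x K -> T K x.
  move=> MK Kt st_sx; have [_] := S_cons x t K MK Kt; apply.
  by rewrite -(fineK (fin t K I MK)) -(fineK (fin x K I MK)); congr EFin.
have sH x : s x H = (1 - l) * s x F + l * s x G by rewrite /s mixS.
(* As [t] is optimal at [F] and [G], replacing it by [x] costs a nonnegative amount at each. The
   weighted sum of these costs is nonpositive because [x] is optimal at [H], so both vanish. *)
have HG t x : T G t -> T H x -> s t H = s x H /\ s t G = s x G.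
  move=> Gt Hx; have := le x t F MF (GF _ Gt).
  have := le x t G MG Gt; have := le t x H MH Hx; rewrite !sH => ? ? ?.
  by split; nra.
apply/seteqP; split=> x.
  by move=> Hx; have [_ ?] := HG g x Gg Hx; exact: (eqT _ g).
by move=> Gx; have [? _] := HG x h Gx Hh; exact: (eqT _ h).
Qed.

End Functional.
End ScoresAtMixtures.

Theorem theorem3p7 (d : measure_display) (O : measurableType d) (R : realType)
    (Asel : Type) (Aexh : set (set Asel)) (M : set (probability O R))
    (T : probability O R -> set Asel)
    (T_Aexh : forall F : probability O R, M F -> Aexh (T F))
    (T_psp : proper_subset_property M T) :
  ~ (selectively_elicitable M T /\ exhaustively_elicitable Aexh M T).
Proof.
case: T_psp => F [G [MF MG TG0 [TGF TFG] mix]] [sel exh].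
have neq_G : T G <> T F by move=> E; apply: TFG; rewrite E.
have neq_0 : set0 <> T F.
  by case: TG0 => g /TGF + E; rewrite -E.
have [e1 e1_01 T_neqG] := exhaustive_mixture_neq T_Aexh exh MF MG neq_G.
have [e2 e2_01 T_neq0] := exhaustive_mixture_neq T_Aexh exh MF MG neq_0.
(* A single mixture has to avoid both values, so its weight must lie below both thresholds. *)
have [|l] := mix (Num.min e1 e2).
  by rewrite lt_min gt_min; lra.
rewrite lt_min => /and3P[l0 le1 le2] [H MH mixH].
have TH0 : T H !=set0.
  apply: contrapT => /nonemptyPn TH_eq0.
  by apply: (T_neq0 l H) TH_eq0; rewrite ?l0.
apply: (T_neqG l H) => //; first by rewrite l0.
have l01 : 0 < l < 1 by lra.
exact: (selective_mixture_eq sel MF MG MH l01 mixH TG0 TGF TH0).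
Qed.
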